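(* Let $p\in(1,\infty)$, let $\varphi_m^D$ and $\psi_m^D$ be the Daubechies orthonormal scaling function and wavelet function of order $m$, respectively, and let $k\ge0$ be an integer. Then $$\lim_{m\to\infty}C_{-k,p}(\varphi_m^D)=\lim_{m\to\infty}\frac{\|\widehat{{}_{-k}\varphi_m^D}\|_p}{\|\widehat{\varphi_m^D}\|_p}=\frac{\pi^k}{(1+pk)^{1/p}}$$ and $$\lim_{m\to\infty}C_{k,p}(\psi_m^D)=\lim_{m\to\infty}\frac{\|\widehat{{}_k\psi_m^D}\|_p}{\|\widehat{\psi_m^D}\|_p}=\pi^{-k}\left(\frac{1-2^{1-pk}}{pk-1}\right)^{1/p}.$$
   Context: The Fourier transform is $\widehat f(\omega)=\frac{1}{\sqrt{2\pi}}\int_{\mathbb{R}}f(x)e^{-i x\omega}\,dx$; $\|\cdot\|_p$ is the $L_p(\mathbb{R})$ norm. For an integer $k$ (possibly negative), ${}_kf$ denotes the function with $\widehat{{}_kf}(\omega)=(i\omega)^{-k}\widehat f(\omega)$, and $C_{k,p}(f)=\|\widehat{{}_kf}\|_p/\|\widehat f\|_p$. $H_m$ is the Daubechies orthonormal low-pass mask of order $m$: a $2\pi$-periodic trigonometric polynomial $H_m(t)=\sum_{\nu=0}^L h_\nu e^{-i\nu t}$ with $$|H_m(t)|^2=1-c_m\int_0^t\sin^{2m-1}\omega\,d\omega,\qquad c_m=\left(\int_0^\pi\sin^{2m-1}\omega\,d\omega\right)^{-1}$$ (equivalently $|H_m(t)|^2=\cos^{2m}(t/2)\sum_{\nu=0}^{m-1}\binom{m-1+\nu}{\nu}\sin^{2\nu}(t/2)$),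 normalized by $H_m(0)=1$. Then $\widehat{\varphi_m^D}(\omega)=\frac{1}{\sqrt{2\pi}}\prod_{\ell=1}^\infty H_m(2^{-\ell}\omega)$ and $\widehat{\psi_m^D}(\omega)=\frac{1}{\sqrt{2\pi}}H_m(\omega/2+\pi)\prod_{\ell=1}^\infty H_m(2^{-\ell-1}\omega)$. *)

(* Defs.v *)
From mathcomp Require Import all_boot all_order all_algebra.
From mathcomp Require Import complex.
From mathcomp Require Import all_classical all_reals all_analysis.

Set Implicit Arguments.
Unset Strict Implicit.
Unset Printing Implicit Defensive.

Import Order.TTheory GRing.Theory Num.Theory.
Import numFieldNormedType.Exports.

Local Open Scope classical_set_scope.
Local Open Scope ring_scope.
Local Open Scope complex_scope.

(* e^{i t} *)
Definition expi (R : realType) (t : R) : R[i] := cos t +i* sin t.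

(* The oriented integral from a to b: the mask formula is used for t < 0 too. *)
Definition oriented_integral (R : realType) (a b : R) (f : R -> R) : R :=
  if a <= b then \int[lebesgue_measure]_(x in `[a, b]) f x
  else - \int[lebesgue_measure]_(x in `[b, a]) f x.

Definition integrableC (R : realType) (f : R -> R[i]) : Prop :=
  (@lebesgue_measure R).-integrable setT (fun x => (complex.Re (f x))%:E) /\
  (@lebesgue_measure R).-integrable setT (fun x => (complex.Im (f x))%:E).

Definition integralC (R : realType) (f : R -> R[i]) : R[i] :=
  (\int[lebesgue_measure]_x complex.Re (f x)) +i*
  (\int[lebesgue_measure]_x complex.Im (f x)).

Definition fourier (R : realType) (f : R -> R[i]) (w : R) : R[i] :=
  ((Num.sqrt (2 * pi))^-1)%:C * integralC (fun x => f x * expi (- (x * w))).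

(* The function _k f is determined by its Fourier transform
   (i w)^{-k} \hat f(w), and only that transform enters C_{k,p}; moreover _k f
   itself may exist only as a distribution.  At w = 0, a null set, a negative
   power of 0 is 0. *)
Definition fourier_shift (R : realType) (k : int) (f : R -> R[i]) (w : R)
    : R[i] :=
  (0 +i* w) ^ (- k) * fourier f w.

(* The L_p(R) norm of a complex function; its value may be +oo. *)
Definition LpnormC (R : realType) (p : R) (g : R -> R[i]) : \bar R :=
  Lnorm (@lebesgue_measure R) p%:E (fun w => (ComplexField.Normc.normc (g w))%:E).

Definition Ckp (R : realType) (k : int) (p : R) (f : R -> R[i]) : \bar R :=
  (LpnormC p (fourier_shift k f) / LpnormC p (fourier f))%E.

Definition mask_const (R : realType) (m : nat) : R :=
  (oriented_integral 0 pi (fun w : R => sin w ^+ (2 * m - 1)))^-1.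

(* For m >= 1.  The mask of order m is not unique (it depends on the choice of
   the spectral factor of |H|^2); this predicate holds of all of them. *)
Definition is_daubechies_mask (R : realType) (m : nat) (H : R -> R[i]) : Prop :=
  [/\ exists (L : nat) (h : nat -> R[i]), forall t : R,
        H t = \sum_(0 <= nu < L.+1) h nu * expi (- (nu%:R * t)),
      forall t : R,
        ComplexField.Normc.normc (H t) ^+ 2 =
        1 - mask_const R m
            * oriented_integral 0 t (fun w : R => sin w ^+ (2 * m - 1))
    & H 0 = 1].

(* \prod_{l >= 1} u l; the topology of R[i] is carried by its alias R[i]^o. *)
Definition infprod (R : realType) (u : nat -> R[i]) : R[i] :=
  lim ((fun n : nat => (\prod_(1 <= l < n.+1) u l : R[i]^o)) @ \oo).

Definition is_scaling_function (R : realType) (H phi : R -> R[i]) : Prop :=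
  integrableC phi /\
  forall w : R,
    fourier phi w =
    ((Num.sqrt (2 * pi))^-1)%:C * infprod (fun l => H (w / 2 ^+ l)).

Definition is_wavelet_function (R : realType) (H psi : R -> R[i]) : Prop :=
  integrableC psi /\
  forall w : R,
    fourier psi w =
    ((Num.sqrt (2 * pi))^-1)%:C * H (w / 2 + pi)
      * infprod (fun l => H (w / 2 ^+ l.+1)).

(* Main.v *)
(** |H_m(t)|^2 = q_m(cos t) for a polynomial q_m with q_m' proportional to
    (1 - x^2)^(m-1), hence |H_m| tends to 1 where cos t > 0 and to 0 where
    cos t < 0, exponentially fast. So |phi^| tends, up to the factor
    (2 pi)^(-1/2), to the indicator of |w| < pi, and |psi^| to that of
    pi < |w| < 2 pi, and the limits of the norms follow by dominated
    convergence.
    The domination must be uniform in m. For N fixed and m large,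
    |H_m(t)|^2 <= 2 (1 + cos t)^N: near cos t = 0 by Bernoulli's inequality, and
    further out because the left-hand side is exponentially small. Since
    1 + cos t = 2 cos^2(t/2), the product over the dyadic scales telescopes
    through sin(2 x) = 2 sin x cos x and decays like |w|^(1-N) with a constant
    independent of m. *)

Require Import Defs.
From mathcomp Require Import all_boot all_order all_algebra.
From mathcomp Require Import complex.
From mathcomp Require Import all_classical all_reals all_analysis.
From mathcomp Require Import measurable_realfun.
From mathcomp Require Import ring lra zify.

Set Implicit Arguments.
Unset Strict Implicit.
Unset Printing Implicit Defensive.

Import Order.TTheory GRing.Theory Num.Theory.
Import numFieldNormedType.Exports.

Local Open Scope classical_set_scope.
Local Open Scope ring_scope.
Local Open Scope complex_scope.

(** * Modulus of the mask *)

Lemma poly_antiderivative (R : numFieldType) (p : {poly R}) :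
  exists q : {poly R}, q^`() = p.
Proof.
exists (\poly_(i < (size p).+1) (p`_i.-1 / i%:R)).
apply/polyP => i; rewrite coef_deriv coef_poly ltnS /=.
case: ltnP => [ip|pi]; last by rewrite mul0rn nth_default.
by rewrite -[LHS]mulr_natr divfK// pnatr_eq0.
Qed.

Lemma horner_mvt (R : realType) (q : {poly R}) (x y : R) : x <= y ->
  exists2 z, x <= z <= y & q.[y] - q.[x] = q^`().[z] * (y - x).
Proof.
move=> xy.
have [|z] := @MVT_segment R (horner q) (horner q^`()) x y xy.
- by apply: continuous_subspaceT; exact: continuous_horner.
- by rewrite in_itv/=; exists z.
Qed.

Section mask_modulus.
Context {R : realType}.
Variables (n : nat) (q : {poly R}).
Hypothesis dq : q^`() = (1 - 'X ^+ 2) ^+ n.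

Let horner_dq (x : R) : q^`().[x] = (1 - x ^+ 2) ^+ n.
Proof. by rewrite dq; rewrite !hornerE. Qed.

(** Substitution by the cosine: the odd power of [sin] is [(1 - cos^2)^n] times [sin], so
    [- q(cos x)] is a primitive of it. *)
Lemma Rintegral_sin_odd (a b : R) : a <= b ->
  \int[lebesgue_measure]_(x in `[a, b]) (sin x ^+ (2 * n.+1 - 1)) =
  q.[cos a] - q.[cos b].
Proof.
rewrite le_eqVlt => /predU1P[<-|ab].
  by rewrite set_itv1 Rintegral_set1 subrr.
have der (x : R) : is_derive x 1 (fun x => - q.[cos x])
    (sin x ^+ (2 * n.+1 - 1)).
  have dc := is_derive1_comp (is_derive_poly q (cos x)) (is_derive_cos x).
  have -> : sin x ^+ (2 * n.+1 - 1) = - (q^`().[cos x] * - sin x).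
    rewrite horner_dq -sin2cos2 -exprM mulrN opprK mulnS addSn add1n.
    by rewrite -exprSr.
  exact: is_deriveN.
rewrite /Rintegral (@continuous_FTC2 _ _ (fun x => - q.[cos x]))//=.
- by rewrite opprK addrC.
- apply: continuous_subspaceT => x.
  exact: (continuous_comp (@continuous_sin R x) (@exprn_continuous R _ _)).
- have cF (x : R) : {for x, continuous (fun x => - q.[cos x])}.
    by apply/differentiable_continuous/derivable1_diffP; case: (der x).
  split.
  + by move=> x _; case: (der x).
  + by apply: cvg_at_right_filter; exact: cF.
  + by apply: cvg_at_left_filter; exact: cF.
- by move=> x _; rewrite derive1E; case: (der x).
Qed.

Lemma oriented_integral_sin_odd (t : R) :
  oriented_integral 0 t (fun w : R => sin w ^+ (2 * n.+1 - 1)) =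
  q.[1] - q.[cos t].
Proof.
rewrite /oriented_integral; case: leP => t0.
  by rewrite Rintegral_sin_odd// cos0.
by rewrite Rintegral_sin_odd ?(ltW t0)// cos0 opprB.
Qed.

Let sqr_le1 (z : R) : -1 <= z <= 1 -> 0 <= 1 - z ^+ 2.
Proof. by move=> /andP[z1 z2]; nra. Qed.

Lemma antiderivative_homo (x y : R) : -1 <= x -> x <= y -> y <= 1 ->
  q.[x] <= q.[y].
Proof.
move=> x1 xy y1; have [z /andP[xz zy] e] := horner_mvt q xy.
rewrite -subr_ge0 e mulr_ge0 ?subr_ge0// horner_dq exprn_ge0// sqr_le1//.
by apply/andP; split; lra.
Qed.

(** This makes the normalizing factor [c^-1] at most the order [n.+1]. On [[0, 1]] one has
    [1 - x^2 >= 1 - x], and [(1 - x)^n] integrates to [1 / (n + 1)] there. *)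
Lemma antiderivative_total : n.+1%:R^-1 <= q.[1] - q.[-1].
Proof.
have q10 : q.[-1] <= q.[0] by apply: antiderivative_homo; lra.
suff h : n.+1%:R^-1 <= q.[1] - q.[0].
  by apply: le_trans h _; rewrite lerD2l lerN2.
(* The two integrals are compared without integrating: the derivative of this polynomial is
   [(n + 1) ((1 - z^2)^n - (1 - z)^n)], nonnegative on [[0, 1]]. *)
have [z /andP[z0 z1]] := horner_mvt (q *+ n.+1 + (1 - 'X) ^+ n.+1) ler01.
rewrite derivD derivMn deriv_exp derivB derivC derivX sub0r mulN1r /= mulNrn.
rewrite !hornerE !hornerMn horner_dq !hornerE subrr subr0 expr1n expr0n/= => e.
rewrite -(@ler_pM2r _ n.+1%:R) ?ltr0n// mulVf ?pnatr_eq0// mulr_natr.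
suff : 0 <= (1 - z ^+ 2) ^+ n - (1 - z) ^+ n.
  move/(mulrn_wge0 n.+1); rewrite mulrnBl.
  by move: e; rewrite mulrnBl; lra.
by rewrite subr_ge0; apply: lerXn2r; rewrite ?nnegrE; nra.
Qed.

Let c := q.[1] - q.[-1].

Let c_gt0 : 0 < c.
Proof. by apply: lt_le_trans antiderivative_total; rewrite invr_gt0 ltr0n. Qed.

Let cV_le : c^-1 <= n.+1%:R.
Proof.
by rewrite -[leRHS]invrK lef_pV2 ?posrE ?invr_gt0 ?ltr0n// antiderivative_total.
Qed.

(** The polynomial that gives [|H|^2] in the variable [cos t]: the primitive [q] rescaled to go from
    0 at -1 to 1 at 1. *)
Definition mask_poly := c^-1 *: (q - q.[-1]%:P).

Lemma mask_poly_le1 x : -1 <= x <= 1 -> mask_poly.[x] <= 1.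
Proof.
move=> /andP[x1 x2]; rewrite !hornerE ler_pdivrMl// mulr1 lerD2r.
exact: antiderivative_homo.
Qed.

(** Mean value theorem on [[-1, x]], an interval of length at most 1; [1 - z^2] increases on
    [[-1, 0]], so the derivative is at most its value at [x]. *)
Lemma mask_poly_neg x : -1 <= x <= 0 ->
  mask_poly.[x] <= n.+1%:R * (1 - x ^+ 2) ^+ n.
Proof.
move=> /andP[x1 x0]; have [z /andP[xz zx] e] := horner_mvt q x1.
rewrite !hornerE ler_pM ?invr_ge0 ?(ltW c_gt0)//.
  by rewrite e horner_dq mulr_ge0 ?exprn_ge0 ?sqr_le1//; lra.
rewrite e horner_dq -[leRHS]mulr1 ler_pM ?exprn_ge0 ?sqr_le1//; try lra.
  by apply: lerXn2r; rewrite ?nnegrE; nra.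
Qed.

(** The mirror argument on [[x, 1]], but with the length [1 - x] kept: at [x = cos t] it decays with
    [t] and makes the errors summable over the dyadic scales. *)
Lemma mask_poly_pos x : 0 <= x <= 1 ->
  1 - mask_poly.[x] <= n.+1%:R * (1 - x) * (1 - x ^+ 2) ^+ n.
Proof.
move=> /andP[x0 x1]; have [z /andP[xz zx] e] := horner_mvt q x1.
have -> : 1 - mask_poly.[x] = c^-1 * (q.[1] - q.[x]).
  rewrite !hornerE; rewrite -{1}(mulVf (lt0r_neq0 c_gt0)) /c; ring.
rewrite -mulrA ler_pM ?invr_ge0 ?(ltW c_gt0)//.
  by rewrite e horner_dq mulr_ge0 ?exprn_ge0 ?sqr_le1//; lra.
rewrite e horner_dq mulrC ler_wpM2l ?subr_ge0//.
by apply: lerXn2r; rewrite ?nnegrE; nra.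
Qed.

Lemma mask_polyE (t : R) :
  1 - mask_const R n.+1 *
      oriented_integral 0 t (fun w : R => sin w ^+ (2 * n.+1 - 1)) =
  mask_poly.[cos t].
Proof.
rewrite /mask_const !oriented_integral_sin_odd cospi !hornerE.
by rewrite -{1}(mulVf (lt0r_neq0 c_gt0)) /c; ring.
Qed.

End mask_modulus.

Lemma daubechies_mask_modulus {R : realType} {m : nat} {H : R -> R[i]} :
  (0 < m)%N -> is_daubechies_mask m H ->
  exists q : {poly R}, [/\
    forall t, ComplexField.Normc.normc (H t) ^+ 2 = q.[cos t],
    forall x, -1 <= x <= 1 -> q.[x] <= 1,
    forall x, -1 <= x <= 0 -> q.[x] <= m%:R * (1 - x ^+ 2) ^+ m.-1 &
    forall x, 0 <= x <= 1 ->
      1 - q.[x] <= m%:R * (1 - x) * (1 - x ^+ 2) ^+ m.-1].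
Proof.
case: m => // n _ [_ HE _].
have [q dq] := poly_antiderivative ((1 - 'X ^+ 2) ^+ n : {poly R}).
exists (mask_poly q); split=> //.
- by move=> t; rewrite HE (mask_polyE dq).
- exact: mask_poly_le1 dq.
- exact: mask_poly_neg dq.
- exact: mask_poly_pos dq.
Qed.

(** * Trigonometric and power estimates *)

Section trigo_inequalities.
Context {R : realType}.
Implicit Types s t w : R.

Lemma cos_ge0_norm t : `|t| <= pi / 2 -> 0 <= cos t.
Proof. by rewrite ler_norml => ?; exact: cos_ge0_pihalf. Qed.

Lemma cos_le0_norm t : pi / 2 <= `|t| <= pi -> cos t <= 0.
Proof.
move=> /andP[t1 t2]; rewrite -cos_norm -[`|t|](subrK (pi / 2)) cosDpihalf.
by rewrite oppr_le0 sin_ge0_pi//; apply/andP; split; lra.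
Qed.

Lemma le_cos_norm s t : `|s| <= `|t| -> `|t| <= pi -> cos t <= cos s.
Proof.
move=> st tpi; rewrite -(cos_norm s) -(cos_norm t).
move: st; rewrite le_eqVlt => /predU1P[->//|st].
by rewrite ltW// ltr_cos// in_itv/= normr_ge0//= (le_trans (ltW st)).
Qed.

Lemma le_sin2_norm s t : `|s| <= `|t| -> `|t| <= pi / 2 ->
  sin s ^+ 2 <= sin t ^+ 2.
Proof.
move=> st tpi; rewrite !sin2cos2 lerD2l lerN2 lerXn2r ?nnegrE//.
- exact: cos_ge0_norm.
- by apply: cos_ge0_norm; exact: le_trans tpi.
- by apply: le_cos_norm => //; apply: le_trans tpi _; have := pi_ge0 R; lra.
Qed.

Lemma normr_sin_le t : `|sin t| <= `|t|.
Proof.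
wlog t0 : t / 0 <= t => [h|].
  case: (lerP 0 t) => [/h//|/ltW t0].
  by rewrite -normrN -sinN -[leRHS]normrN h// oppr_ge0.
have [|z _] := @MVT_segment R sin cos 0 t t0.
  by apply: continuous_subspaceT; exact: continuous_sin.
by rewrite sin0 !subr0 => ->; rewrite normrM ler_piMl// cos_max.
Qed.

Lemma cos_ge_1B t : 1 - cos t <= `|t|.
Proof.
rewrite -cos_norm.
have [|z _] := @MVT_segment R cos (fun x => - sin x) 0 `|t| (normr_ge0 t).
  by apply: continuous_subspaceT; exact: continuous_cos.
rewrite cos0 subr0 -opprB => /(congr1 -%R); rewrite opprK => ->.
by rewrite mulNr opprK ler_piMl// sin_le1.
Qed.

Lemma cos_double t : 1 + cos (t *+ 2) = 2 * cos t ^+ 2.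
Proof. by rewrite cos_mulr2n; ring. Qed.

(** Take the least [j] with [|w| <= pi 2^j]. At this scale the cosine is strictly negative, so the
    mask factor there is the small one. *)
Lemma dyadic_scale w : pi < `|w| ->
  exists2 j, (0 < j)%N & pi / 2 < `|w| / 2 ^+ j <= pi.
Proof.
move=> piw.
have ex : exists j, `|w| <= pi * 2 ^+ j.
  exists (Num.truncn `|w|).+1.
  have /andP[_ /ltW h] := truncn_itv (normr_ge0 w).
  apply: le_trans h _; rewrite -[leLHS]mul1r.
  apply: ler_pM => //; first by have := pi_ge2 R; lra.
  by rewrite -natrX ler_nat ltnW// ltn_expl.
have [[|j] wj jmin] := ex_minnP ex.
  by move: wj; rewrite expr0 mulr1 leNgt piw.
exists j.+1 => //; rewrite ler_pdivrMr ?exprn_gt0// wj andbT.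
have : pi * 2 ^+ j < `|w| by rewrite ltNge; apply/negP => /jmin; rewrite ltnn.
rewrite ltr_pdivlMr ?exprn_gt0//; apply: le_lt_trans.
by rewrite exprS mulrA divfK.
Qed.

Lemma dyadic_double w n : w / 2 ^+ n.+1 *+ 2 = w / 2 ^+ n.
Proof. by rewrite exprSr invfM mulrA -[LHS]mulr_natr divfK. Qed.

(** Viète's product, by iterating [sin (2 x) = 2 sin x cos x]. The exponent [l.+1] comes from the
    half angle in [1 + cos t = 2 cos^2 (t / 2)] at [t = w / 2^l]. *)
Lemma prod_cos_dyadic w n :
  (\prod_(1 <= l < n.+1) cos (w / 2 ^+ l.+1)) * sin (w / 2 ^+ n.+1) * 2 ^+ n =
  sin (w / 2).
Proof.
elim: n => [|n IH]; first by rewrite big_geq// expr0 mul1r mulr1 expr1.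
rewrite big_nat_recr//= -IH.
rewrite -(dyadic_double w n.+1) sin_mulr2n -[(_ * _) *+ 2]mulr_natr.
rewrite [2 ^+ n.+1]exprS.
set P := \prod_(_ <= _ < _) _; set c := cos _; set d := sin _; ring.
Qed.

End trigo_inequalities.

Section power_limits.
Context {R : realType}.

Lemma bernoulli_ineq (x : R) n : -1 <= x -> 1 + n%:R * x <= (1 + x) ^+ n.
Proof.
move=> x1; elim: n => [|n IH]; first by rewrite mul0r addr0 expr0.
rewrite exprS; apply: (@le_trans _ _ ((1 + x) * (1 + n%:R * x))).
  rewrite -natr1; have := ler0n R n; nra.
by rewrite ler_wpM2l//; lra.
Qed.

(** With [r = sqrt q], Bernoulli's inequality at [1 / r] bounds [n r^n], so [n q^n = (n r^n) r^n] is
    squeezed by a geometric sequence. *)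
Lemma cvg_natr_mul_expr (q : R) : 0 <= q < 1 ->
  (fun n => n%:R * q ^+ n) @ \oo --> 0.
Proof.
move=> /andP[q0 q1].
have [->|/eqP q_neq0] := eqVneq q 0.
  apply: cvg_near_cst; exists 1%N => // n /= n0.
  by rewrite expr0n (gtn_eqF n0) mulr0.
pose r := Num.sqrt q.
have r0 : 0 < r by rewrite sqrtr_gt0 lt_neqAle q0 andbT eq_sym; apply/eqP.
have r1 : r < 1 by rewrite -sqrtr1 ltr_sqrt.
have qE : q = r * r by rewrite -expr2 sqr_sqrtr.
pose C := (r^-1 - 1)^-1.
have C0 : 0 < r^-1 - 1 by rewrite subr_gt0 invf_gt1.
have nr n : n%:R * r ^+ n <= C.
  have := @bernoulli_ineq (r^-1 - 1) n.
  have -> : 1 + (r^-1 - 1) = r^-1 by ring.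
  move=> /(_ _)/wrap[]; first by lra.
  rewrite exprVn => h; rewrite /C -[leRHS]mul1r ler_pdivlMr// mulrAC.
  by rewrite -ler_pdivlMr ?exprn_gt0// mul1r; lra.
apply: (@squeeze_cvgr _ _ _ _ (fun=> 0) (fun n => C * r ^+ n)).
- near=> n; rewrite mulr_ge0 ?exprn_ge0//= qE exprMn mulrA.
  by rewrite ler_wpM2r ?exprn_ge0// ltW.
- exact: cvg_cst.
- rewrite -[X in _ --> X](mulr0 C); apply: cvgM; first exact: cvg_cst.
  apply: cvg_expr.
  by rewrite gtr0_norm.
Unshelve. all: by end_near. Qed.

Lemma cvg_natr_mul_expr_pred (q : R) N : 0 <= q < 1 ->
  (fun n => n%:R * q ^+ (n.-1 - N)) @ \oo --> 0.
Proof.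
move=> /andP[q0 q1].
(* [q] may vanish; the larger ratio [s] is invertible, so the shift of the exponent is paid for by
   the constant factor [s^-(N+1)]. *)
pose s := Num.max q 2^-1.
have s0 : 0 < s by rewrite lt_max invr_gt0 ltr0n orbT.
have s1 : s < 1 by rewrite gt_max q1/=; lra.
apply: (@squeeze_cvgr _ _ _ _ (fun=> 0)
  (fun n => (n%:R * s ^+ n) * s ^- N.+1)).
- near=> n; have nN : (N.+1 <= n)%N by near: n; exact: nbhs_infty_ge.
  rewrite mulr_ge0 ?exprn_ge0//= -mulrA ler_wpM2l//.
  rewrite -{2}(subnK nN) exprD mulfK ?expf_neq0 ?gt_eqF//.
  rewrite -subn1 -subnDA add1n lerXn2r ?nnegrE ?(ltW s0)//.
  by rewrite le_max lexx.
- exact: cvg_cst.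
- rewrite -[X in _ --> X](mul0r (s ^- N.+1)); apply: cvgM; last exact: cvg_cst.
  by apply: cvg_natr_mul_expr; rewrite (ltW s0).
Unshelve. all: by end_near. Qed.

Lemma cvg_1B_natr_mul_expr (a q : R) : 0 <= q < 1 ->
  (fun n => 1 - n%:R * a * q ^+ n.-1) @ \oo --> (1 : R).
Proof.
move=> /(cvg_natr_mul_expr_pred 0) h.
rewrite (_ : (fun n => _) = fun n => 1 - a * (n%:R * q ^+ (n.-1 - 0))).
  rewrite -[X in _ --> X]subr0 -[X in _ - X](mulr0 a).
  by apply: cvgB; [exact: cvg_cst|apply: cvgM => //; exact: cvg_cst].
by apply/funext => n; rewrite subn0 mulrCA mulrA.
Qed.

End power_limits.

(** * Dyadic products of mask moduli *)

Section product_modulus.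
Context {R : realType}.
Implicit Types (h g : R -> R) (w t : R).

(* All that is used of h = |H_m|; g below is then sqrt(2 pi) |phi^|. *)
Definition low_pass_modulus (m : nat) h :=
  [/\ forall t, 0 <= h t <= 1,
      forall t, cos t <= 0 -> h t ^+ 2 <= m%:R * (sin t ^+ 2) ^+ m.-1 &
      forall t, 0 <= cos t ->
        1 - h t ^+ 2 <= m%:R * (1 - cos t) * (sin t ^+ 2) ^+ m.-1].

Definition dyadic_product h g :=
  forall w, (fun n => \prod_(1 <= l < n.+1) h (w / 2 ^+ l)) @ \oo --> g w.

Section fixed_order.
Variables (m : nat) (h g : R -> R).
Hypotheses (hh : low_pass_modulus m h) (hg : dyadic_product h g).
Arguments hg : clear implicits.

Let h01 t : 0 <= h t <= 1. Proof. by case: hh. Qed.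
Let h0 t : 0 <= h t. Proof. by case/andP: (h01 t). Qed.

Let prod01 w n : 0 <= \prod_(1 <= l < n.+1) h (w / 2 ^+ l) <= 1.
Proof. by rewrite prodr_ge0//= prodr_ile1. Qed.

Lemma dyadic_product_ge0 w : 0 <= g w.
Proof.
refine (cvgr_to_ge (hg w) _); apply: nearW => n; by case/andP: (prod01 w n).
Qed.

Lemma dyadic_product_le w n : g w <= \prod_(1 <= l < n.+1) h (w / 2 ^+ l).
Proof.
rewrite -(cvg_lim _ (hg w))//.
apply: nonincreasing_cvgn_ge; last exact: cvgP (hg w).
apply/nonincreasing_seqP => i; rewrite big_nat_recr//= ler_piMr//.
  by case/andP: (prod01 w i).
by case/andP: (h01 (w / 2 ^+ i.+1)).
Qed.

Lemma dyadic_product_le1 w : g w <= 1.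
Proof. by apply: le_trans (dyadic_product_le w 0) _; rewrite big_geq. Qed.

Lemma dyadic_product_le_factor w l : (0 < l)%N -> g w <= h (w / 2 ^+ l).
Proof.
case: l => // l _; apply: le_trans (dyadic_product_le w l.+1) _.
by rewrite big_nat_recr//= ler_piMl//; case/andP: (prod01 w l).
Qed.

(** All scales [t = w / 2^l] satisfy [|t| <= pi / 2], and [1 - cos t <= |t|], so each squared factor
    falls short of 1 by at most [m |t| S^(m-1)]. For factors in [[0, 1]] the shortfall of the
    product is at most the sum, and [|w| / 2^l] sums to [|w|]. *)
Lemma dyadic_product_ge w : `|w| <= pi ->
  1 - m%:R * `|w| * (sin (w / 2) ^+ 2) ^+ m.-1 <= g w ^+ 2.
Proof.
move=> wpi; set S := sin _ ^+ 2.
have S0 : 0 <= S ^+ m.-1 by rewrite exprn_ge0// sqr_ge0.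
rewrite expr2; refine (cvgr_to_ge (cvgM (hg w) (hg w)) _).
apply: nearW => n /=; rewrite -expr2.
(* The partial sum [1 - 2^-n] of the geometric series is kept so that the induction closes. *)
suff : 1 - (\prod_(1 <= l < n.+1) h (w / 2 ^+ l)) ^+ 2 <=
  m%:R * `|w| * S ^+ m.-1 * (1 - 2 ^- n).
  have : m%:R * `|w| * S ^+ m.-1 * (1 - 2 ^- n) <= m%:R * `|w| * S ^+ m.-1.
    by rewrite ler_piMr ?mulr_ge0// lerBlDr lerDl invr_ge0 exprn_ge0.
  by move=> h1 h2; rewrite lerBlDr -lerBlDl; exact: le_trans h2 h1.
elim: n => [|n IH].
  by rewrite big_geq// expr0 expr1n invr1 !subrr mulr0.
rewrite big_nat_recr//=.
set P := \prod_(_ <= _ < _) _ in IH *; set t := w / _.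
have tw : `|t| = `|w| / 2 ^+ n.+1.
  by rewrite normrM normfV normrX [`|2|]ger0_norm.
have tw2 : `|t| <= `|w / 2|.
  rewrite tw normrM normfV [`|2|]ger0_norm// ler_wpM2l//.
  rewrite lef_pV2 ?posrE ?exprn_gt0//.
  by rewrite exprS ler_peMr// -natrX ler1n expn_gt0.
have wpi2 : `|w / 2| <= pi / 2.
  by rewrite normrM normfV [`|2|]ger0_norm// ler_wpM2r.
have [_ _ /(_ t)] := hh; move=> /(_ (cos_ge0_norm (le_trans tw2 wpi2))) ht.
have {}ht : 1 - h t ^+ 2 <= m%:R * `|w| * S ^+ m.-1 * 2 ^- n.+1.
  apply: le_trans ht _.
  have -> : m%:R * `|w| * S ^+ m.-1 * 2 ^- n.+1 = m%:R * `|t| * S ^+ m.-1.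
    by rewrite tw; ring.
  apply: ler_pM.
  - by rewrite mulr_ge0// subr_ge0 cos_le1.
  - by rewrite exprn_ge0// sqr_ge0.
  - by rewrite ler_wpM2l// cos_ge_1B.
  - by rewrite lerXn2r ?nnegrE ?sqr_ge0// le_sin2_norm.
have P2 : 0 <= P ^+ 2 <= 1.
  by rewrite sqr_ge0 expr_le1//; case/andP: (prod01 w n).
have h2 : 0 <= 1 - h t ^+ 2.
  by rewrite subr_ge0 expr_le1//; case/andP: (h01 t).
have dn : (2 ^- n : R) = 2 * 2 ^- n.+1.
  by rewrite exprS invfM mulrA mulfV ?mul1r.
have Ph : P ^+ 2 * (1 - h t ^+ 2) <= 1 - h t ^+ 2.
  by rewrite ler_piMl//; case/andP: P2.
move: IH; rewrite dn [(P * h t) ^+ 2]exprMn.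
move: Ph ht; set A := m%:R * _ * _; lra.
Qed.

(** Each of the [j] squared factors is at most [2^(N+2) cos^(2N+2)], while telescoping gives
    [C^2 4^j <= 2] for the product [C] of the cosines. Raised to the power [N + 1], this leaves
    [2^(N+1) 2^(-jN)], and [2^-j <= pi / |w|] at the scale [j]. *)
Lemma prod_modulus_decay N w j :
    (forall t, h t ^+ 2 <= 2 * (1 + cos t) ^+ N.+1) ->
    pi / 2 < `|w| / 2 ^+ j <= pi ->
  (\prod_(1 <= l < j.+1) h (w / 2 ^+ l)) ^+ 2 <=
  2 ^+ N.+1 * (pi / `|w|) ^+ N.
Proof.
move=> hN /andP[wj wj'].
have w0 : 0 < `|w|.
  have : 0 < `|w| / 2 ^+ j by apply: lt_trans wj; rewrite divr_gt0// pi_gt0.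
  by rewrite pmulr_lgt0// invr_gt0 exprn_gt0.
pose C := \prod_(1 <= l < j.+1) cos (w / 2 ^+ l.+1).
have step : (\prod_(1 <= l < j.+1) h (w / 2 ^+ l)) ^+ 2 <=
    (2 ^+ N.+2) ^+ j * (C ^+ 2) ^+ N.+1.
  have -> : (2 ^+ N.+2) ^+ j = \prod_(1 <= l < j.+1) (2 ^+ N.+2) :> R.
    by rewrite prodr_const_nat subn1.
  rewrite -!prodrXl -big_split/=.
  apply: ler_prod => l _; rewrite sqr_ge0/=; apply: le_trans (hN _) _.
  by rewrite -dyadic_double cos_double exprMn [in leRHS]exprS mulrA.
apply: le_trans step _.
have sC : 1 / 2 * (C ^+ 2 * 4 ^+ j) <= 1.
  (* Half angle: [cos (w / 2^j) <= 0] forces [sin^2 >= 1/2] here, so the sine in Viète's product can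
     be divided out. *)
  have sin2 : 1 / 2 <= sin (w / 2 ^+ j.+1) ^+ 2.
    have := cos_double (w / 2 ^+ j.+1); rewrite dyadic_double cos2sin2.
    have : cos (w / 2 ^+ j) <= 0.
      apply: cos_le0_norm; rewrite normrM normfV normrX [`|2|]ger0_norm//.
      by rewrite (ltW wj).
    lra.
  apply: (@le_trans _ _ (sin (w / 2) ^+ 2)); last first.
    by rewrite -[leRHS](cos2Dsin2 (w / 2)) lerDr sqr_ge0.
  rewrite -(prod_cos_dyadic w j) !exprMn -exprM mulnC exprM.
  have -> : (2 ^+ 2 : R) = 4 by ring.
  rewrite mulrAC [leLHS]mulrC ler_wpM2l// mulr_ge0 ?sqr_ge0 ?exprn_ge0//.
have {}sC : (C ^+ 2) ^+ N.+1 * (4 ^+ j) ^+ N.+1 <= 2 ^+ N.+1.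
  have D0 : 0 <= C ^+ 2 * 4 ^+ j by rewrite mulr_ge0 ?sqr_ge0 ?exprn_ge0.
  rewrite -exprMn; apply: lerXn2r; rewrite ?nnegrE//.
  by move: sC; set D := C ^+ 2 * _; lra.
have piw : 2 ^- j <= pi / `|w|.
  rewrite -(@ler_pM2r _ `|w|)// divfK ?gt_eqF// mulrC//.
have E : (4 ^+ j) ^+ N.+1 = (2 ^+ N.+2) ^+ j * (2 ^+ j) ^+ N :> R.
  have -> : (4 : R) = 2 ^+ 2 by ring.
  by rewrite -!exprM -exprD; congr (_ ^+ _); nia.
rewrite -(@ler_pM2r _ ((2 ^+ j) ^+ N)) ?exprn_gt0//.
apply: (@le_trans _ _ (2 ^+ N.+1)).
  by apply: le_trans sC; rewrite E [leLHS]mulrAC [leLHS]mulrC.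
rewrite -mulrA -exprMn ler_peMr ?exprn_ge0// exprn_ege1//.
by rewrite -ler_pdivrMr ?exprn_gt0// div1r.
Qed.

(** The exponent [(N * 2).+1] is due to [prod_modulus_decay] bounding the square of the product:
    [2 N] powers of [pi / |w|] become [N] after the root. For [|w| <= pi] the bound [g <= 1]
    suffices. *)
Lemma dyadic_product_decay N w :
    (forall t, h t ^+ 2 <= 2 * (1 + cos t) ^+ (N * 2).+1) ->
  `|w| ^+ N * g w <= 2 ^+ N.+1 * pi ^+ N.
Proof.
move=> hN; have [wpi|piw] := lerP `|w| pi.
  have g0 := dyadic_product_ge0 w.
  apply: (@le_trans _ _ (pi ^+ N)).
    rewrite -[leRHS]mulr1 ler_pM ?exprn_ge0 ?dyadic_product_le1//.
    by rewrite lerXn2r ?nnegrE ?pi_ge0.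
  by rewrite ler_peMl ?exprn_ge0 ?pi_ge0// exprn_ege1// ler1n.
have [j j0 wj] := dyadic_scale piw.
have w0 : 0 < `|w| by apply: lt_trans piw; exact: pi_gt0.
rewrite mulrC -ler_pdivlMr ?exprn_gt0//.
rewrite -(@ler_pXn2r _ 2) ?nnegrE ?dyadic_product_ge0//; last first.
  by rewrite divr_ge0 ?mulr_ge0 ?exprn_ge0 ?pi_ge0.
apply: le_trans (le_trans _ (prod_modulus_decay hN wj)) _.
  rewrite lerXn2r ?nnegrE ?dyadic_product_ge0 ?dyadic_product_le//.
  by case/andP: (prod01 w j).
rewrite -[_ * _ / _]mulrA -expr_div_n [leRHS]exprMn -[_ ^+ N ^+ 2]exprM.
rewrite ler_wpM2r ?exprn_ge0 ?divr_ge0 ?pi_ge0//.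
by rewrite -exprM ler_weXn2l ?ler1n//; lia.
Qed.

End fixed_order.

(** The interval is split at [- a]. Closer to 0, Bernoulli's inequality bounds the power of [1 + x]
    below by 1/2, and the entry 1 of the minimum suffices. Further out, that power is pulled out of
    [(1 - x^2)^(m-1)], and the rest tends to 0 uniformly in [x]. *)
Lemma mask_poly_dominated N : exists m0, forall m (x : R), (m0 <= m)%N ->
  -1 <= x <= 0 -> Num.min 1 (m%:R * (1 - x ^+ 2) ^+ m.-1) <= 2 * (1 + x) ^+ N.
Proof.
case: N => [|N].
  by exists 0%N => m x _ _; rewrite expr0 mulr1 ge_min ler1n.
(* Chosen so that [N.+1%:R * a = 1/2], the loss allowed in Bernoulli's inequality. *)
pose a : R := (2 * N.+1%:R)^-1.
have N0 : 0 < 2 * N.+1%:R :> R by rewrite mulr_gt0.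
have a0 : 0 < a by rewrite invr_gt0.
have a1 : a <= 2^-1.
  by rewrite lef_pV2 ?posrE// -[leLHS]mulr1 ler_wpM2l// ler1n.
have a2 : 0 <= 1 - a ^+ 2 < 1 by apply/andP; split; nra.
(* This tolerance cancels the factor [(1 - x)^(N+1)], which is at most [2^(N+1)]. *)
have e0 : 0 < (2 ^+ N.+1)^-1 :> R by rewrite invr_gt0 exprn_gt0.
have /cvgrPdist_lt/(_ _ e0)[m0 _ m0P] := cvg_natr_mul_expr_pred N.+1 a2.
exists (maxn m0 N.+2) => m x; rewrite geq_max => /andP[mm0 mN] /andP[x1 x0].
rewrite ge_min; have [xa|ax] := leP (- a) x.
  apply/orP; left; have := bernoulli_ineq N.+1 x1.
  have : N.+1%:R * - a <= N.+1%:R * x by rewrite ler_wpM2l.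
  have -> : N.+1%:R * - a = - 2^-1.
    by rewrite /a invfM mulrN mulrCA mulfV ?mulr1 ?pnatr_eq0.
  lra.
apply/orP; right.
have {m0P mm0} := m0P m mm0.
rewrite sub0r normrN => /ltW/(le_trans (ler_norm _)).
rewrite -[leRHS]mul1r ler_pdivlMr ?exprn_gt0// => h.
have x2 : 0 <= 1 - x ^+ 2 <= 1 - a ^+ 2 by apply/andP; split; nra.
have m1 : m.-1 = (N.+1 + (m.-1 - N.+1))%N by clear -mN; lia.
have -> : 1 - x ^+ 2 = (1 + x) * (1 - x) by ring.
rewrite {1}m1 exprD exprMn.
have -> : (1 + x) * (1 - x) = 1 - x ^+ 2 by ring.
rewrite mulrCA -mulrA mulrC.
apply: ler_wpM2r; first by rewrite exprn_ge0//; lra.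
suff : (1 - x) ^+ N.+1 * (m%:R * (1 - x ^+ 2) ^+ (m.-1 - N.+1)) <= 1.
  by move=> h2; apply: le_trans h2 _; rewrite ler1n.
apply: le_trans h; rewrite mulrC ler_pM ?mulr_ge0 ?exprn_ge0//.
- by case/andP: x2.
- lra.
- case/andP: x2 => x2 x2'; rewrite ler_wpM2l// lerXn2r ?nnegrE//.
  exact: le_trans x2'.
- by rewrite lerXn2r ?nnegrE//; lra.
Qed.

Lemma low_pass_modulus_le N : exists m0, forall m h, (m0 <= m)%N ->
  low_pass_modulus m h -> forall t, h t ^+ 2 <= 2 * (1 + cos t) ^+ N.
Proof.
have [m0 m0P] := mask_poly_dominated N; exists m0 => m h mm0 [h01 hneg _] t.
have h1 : h t ^+ 2 <= 1 by rewrite expr_le1//; case/andP: (h01 t).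
have [c0|/ltW c0] := leP 0 (cos t).
  apply: le_trans h1 _; rewrite -[leLHS]mulr1 ler_pM// ?ler1n//.
  by rewrite exprn_ege1// lerDl.
apply: le_trans (m0P m (cos t) mm0 _); last by rewrite cos_geN1.
by rewrite le_min h1 -sin2cos2 hneg.
Qed.

End product_modulus.

(** * Pointwise limits and uniform majorants as the order grows *)

Section limits.
Context {R : realType}.
Implicit Types w t : R.
Variables (h g : nat -> R -> R).
Hypothesis hh : forall m, (0 < m)%N -> low_pass_modulus m (h m).
Hypothesis hg : forall m, (0 < m)%N -> dyadic_product (h m) (g m).

Let sin2_lt1 t : cos t != 0 -> 0 <= sin t ^+ 2 < 1.
Proof.
move=> c0; rewrite sqr_ge0 sin2cos2 /= ltrBlDr ltrDl.
by rewrite lt_neqAle sqr_ge0 andbT eq_sym sqrf_eq0.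
Qed.

Lemma low_pass_modulus_cvg0 t : cos t < 0 -> (fun m => h m t) @ \oo --> (0 : R).
Proof.
move=> c0; have : cos t != 0 by rewrite lt_eqF.
move=> /sin2_lt1/(cvg_natr_mul_expr_pred 0).
move=> /(cvg_comp _ _)/(_ (@sqrt_continuous R _)); rewrite sqrtr0.
apply: squeeze_cvgr; last exact: cvg_cst.
near=> m; have m0 : (0 < m)%N by near: m; exact: nbhs_infty_gt.
have [/(_ t)/andP[h0 h1] /(_ _ (ltW c0)) hn _] := hh m0.
by rewrite h0/= -[leLHS]ger0_norm// -sqrtr_sqr ler_wsqrtr//= subn0.
Unshelve. all: by end_near. Qed.

Lemma low_pass_modulus_cvg1 t : 0 < cos t -> (fun m => h m t) @ \oo --> (1 : R).
Proof.
move=> c0; have : cos t != 0 by rewrite gt_eqF.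
move=> /sin2_lt1/(cvg_1B_natr_mul_expr (1 - cos t)) l1.
apply: squeeze_cvgr l1 (cvg_cst _).
near=> m; have m0 : (0 < m)%N by near: m; exact: nbhs_infty_gt.
have [/(_ t)/andP[h0 h1] _ /(_ _ (ltW c0)) hp] := hh m0.
rewrite h1 andbT; apply: (@le_trans _ _ (h m t ^+ 2)).
  by rewrite lerBlDr -lerBlDl.
by rewrite expr2 ler_piMl.
Unshelve. all: by end_near. Qed.

Lemma dyadic_product_cvg1 w : `|w| < pi -> (fun m => g m w) @ \oo --> (1 : R).
Proof.
move=> wpi.
have c0 : cos (w / 2) != 0.
  rewrite gt_eqF// cos_gt0_pihalf// -ltr_norml normrM normfV [`|2|]ger0_norm//.
  by rewrite ltr_pM2r.
apply: squeeze_cvgr (cvg_1B_natr_mul_expr `|w| (sin2_lt1 c0)) (cvg_cst _).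
near=> m; have m0 : (0 < m)%N by near: m; exact: nbhs_infty_gt.
have g0 := dyadic_product_ge0 (hh m0) (hg m0) w.
have g1 := dyadic_product_le1 (hh m0) (hg m0) w.
rewrite g1 andbT; apply: (@le_trans _ _ (g m w ^+ 2)).
  exact: dyadic_product_ge (hh m0) (hg m0) _ (ltW wpi).
by rewrite expr2 ler_piMl.
Unshelve. all: by end_near. Qed.

(** One factor suffices, the one at the scale given by [dyadic_scale]: all the others are at most
    1. *)
Lemma dyadic_product_cvg0 w : pi < `|w| -> (fun m => g m w) @ \oo --> (0 : R).
Proof.
move=> /dyadic_scale[j j0 /andP[j1 j2]].
have : cos (w / 2 ^+ j) < 0.
  rewrite -cos_norm normrM normfV normrX [`|2|]ger0_norm//.
  rewrite -[X in cos X](subrK (pi / 2)) cosDpihalf oppr_lt0 sin_gt0_pi//.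
  by apply/andP; split; lra.
move=> /low_pass_modulus_cvg0; apply: squeeze_cvgr; last exact: cvg_cst.
near=> m; have m0 : (0 < m)%N by near: m; exact: nbhs_infty_gt.
rewrite (dyadic_product_ge0 (hh m0) (hg m0))/=.
exact: dyadic_product_le_factor (hh m0) (hg m0) _ _ j0.
Unshelve. all: by end_near. Qed.

(** The decay estimates at the exponents [k] and [k.+2], added, bound [|w|^k (1 + w^2) g]. The
    constant is chosen before [m], as dominated convergence requires. *)
Lemma dyadic_product_dominated k : exists C : R, \forall m \near \oo,
  forall w, `|w| ^+ k * g m w <= C / (1 + w ^+ 2).
Proof.
pose D n : R := 2 ^+ n.+1 * pi ^+ n.
have dec n : \forall m \near \oo, forall w, `|w| ^+ n * g m w <= D n.
  have [m1 m1P] := @low_pass_modulus_le R (n * 2).+1.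
  near=> m; have m0 : (0 < m)%N by near: m; exact: nbhs_infty_gt.
  have mm1 : (m1 <= m)%N by near: m; exact: nbhs_infty_ge.
  have hN := m1P _ _ mm1 (hh m0).
  by move=> w; exact: dyadic_product_decay (hh m0) (hg m0) _ _ hN.
exists (D k + D k.+2); near=> m => w.
have d1 : forall v, `|v| ^+ k * g m v <= D k by near: m; exact: dec.
have d2 : forall v, `|v| ^+ k.+2 * g m v <= D k.+2 by near: m; exact: dec.
have w2 : 0 < 1 + w ^+ 2 by rewrite ltr_wpDr ?sqr_ge0.
rewrite ler_pdivlMr// mulrDr mulr1 -(real_normK (num_real w)).
rewrite mulrAC -exprD addn2.
exact: lerD.
Unshelve. all: by end_near. Qed.

(* |H_m(w/2 + pi)|^2 <= m sin(w/2)^(2(m-1)) absorbs the pole |w|^(-k) at 0. *)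
Lemma wavelet_modulus_dominated k : exists C : R, \forall m \near \oo,
  forall w, `|w| ^- k * (h m (w / 2 + pi) * g m (w / 2)) <= C / (1 + w ^+ 2).
Proof.
have [C hC] := dyadic_product_dominated 0.
have q4 : 0 <= (4^-1 : R) < 1 by rewrite invr_ge0 ler0n/= invf_lt1// ltr1n.
have h4 := cvgr_le _ (cvg_natr_mul_expr_pred 0 q4) _ ltr01.
(* [4 C] serves [|w| >= 1], where the pole is at most 1 and [1 + w^2 <= 4 (1 + (w / 2)^2)]; 2 serves
   [|w| < 1], where the left-hand side is at most 1. *)
exists (2 + 4 * C); near=> m => w.
have m0 : (0 < m)%N by near: m; exact: nbhs_infty_gt.
have mk : (k < m)%N by near: m; exact: nbhs_infty_gt.
have [h01 hneg _] := hh m0.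
have /andP[h0 h1] := h01 (w / 2 + pi).
have g0 := dyadic_product_ge0 (hh m0) (hg m0) (w / 2).
have g1 := dyadic_product_le1 (hh m0) (hg m0) (w / 2).
have w2 : 0 < 1 + w ^+ 2 by rewrite ltr_wpDr ?sqr_ge0.
have w4 : 0 < 1 + (w / 2) ^+ 2 by rewrite ltr_wpDr ?sqr_ge0.
have gC : forall w, g m w <= C / (1 + w ^+ 2).
  have gC0 : forall v, `|v| ^+ 0 * g m v <= C / (1 + v ^+ 2) by near: m.
  by move=> v; have := gC0 v; rewrite expr0 mul1r.
have C0 : 0 <= C.
  have := gC (w / 2); rewrite ler_pdivlMr//; apply: le_trans.
  by rewrite mulr_ge0// ltW.
have [w1|w1] := lerP 1 `|w|.
  apply: (@le_trans _ _ (g m (w / 2))).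
    rewrite mulrA ler_piMl// mulr_ile1 ?invr_ge0 ?exprn_ge0//.
    by rewrite invf_le1 ?exprn_gt0 ?exprn_ege1// (lt_le_trans ltr01).
  apply: le_trans (gC _) _.
  rewrite ler_pdivrMr// mulrAC ler_pdivlMr//.
  by have := sqr_ge0 w; rewrite expr_div_n; nra.
apply: (@le_trans _ _ 1); last first.
  rewrite ler_pdivlMr// mul1r; have : w ^+ 2 <= 1.
    by rewrite -(real_normK (num_real w)) expr_le1// ltW.
  lra.
apply: (@le_trans _ _ (`|w| ^- k * h m (w / 2 + pi))).
  by rewrite mulrA ler_piMr// mulr_ge0// invr_ge0 exprn_ge0.
(* At 0 the negative power is 0 if [k > 0], by [0^-1 = 0], and 1 if [k = 0]. *)
have [->|w0] := eqVneq w 0.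
  rewrite normr0; case: (k) => [|i]; last by rewrite exprS mul0r invr0 mul0r.
  by rewrite expr0 invr1 mul1r; case/andP: (h01 (0 / 2 + pi)).
rewrite mulrC ler_pdivrMr ?exprn_gt0 ?normr_gt0// mul1r.
(* After squaring: [m (w^2 / 4)^(m-1) <= w^(2 (m-1)) <= w^(2 k)], since [m / 4^(m-1) <= 1] for large
   [m], [k < m] and [|w| < 1]. *)
rewrite -(@ler_pXn2r _ 2) ?nnegrE ?exprn_ge0//.
rewrite -exprM mulnC exprM (real_normK (num_real w)).
have cw : 0 <= cos (w / 2).
  apply: cos_ge0_norm; rewrite normrM normfV [`|2|]ger0_norm// ler_wpM2r//.
  by apply: le_trans (ltW w1) _; have := pi_ge2 R; lra.
apply: le_trans (hneg _ _) _; first by rewrite cosDpi oppr_le0.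
rewrite sinDpi sqrrN.
have sw : sin (w / 2) ^+ 2 <= w ^+ 2 * 4^-1.
  have -> : w ^+ 2 * 4^-1 = `|w / 2| ^+ 2.
    by rewrite (real_normK (num_real _)); field.
  by rewrite -(real_normK (num_real (sin _))) lerXn2r ?nnegrE// normr_sin_le.
apply: (@le_trans _ _ (m%:R * (w ^+ 2 * 4^-1) ^+ m.-1)).
  rewrite ler_wpM2l//; apply: lerXn2r; rewrite ?nnegrE//; first exact: sqr_ge0.
  by rewrite mulr_ge0// sqr_ge0.
rewrite exprMn mulrCA; apply: (@le_trans _ _ ((w ^+ 2) ^+ m.-1)).
  rewrite ler_piMr//; first by rewrite exprn_ge0// sqr_ge0.
  have : m%:R * 4^-1 ^+ (m.-1 - 0) <= 1 :> R by near: m; exact: h4.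
  by rewrite subn0.
have w21 : w ^+ 2 <= 1.
  by rewrite -(real_normK (num_real w)) expr_le1// ltW.
by rewrite ler_wiXn2l ?sqr_ge0// -ltnS prednK.
Unshelve. all: by end_near. Qed.

End limits.

(** * Integrals over symmetric annuli *)

Section annulus_integral.
Context {R : realType}.
Let mu := @lebesgue_measure R.
Implicit Types a b s w x : R.

(** At 0, the case [s = 0] stands apart: [powR 0 0] is 1, so the function is constant. For [s > 0]
    the left limit follows from the right one by evenness. *)
Lemma continuous_normr_powR s x : (x != 0) || (0 <= s) ->
  {for x, continuous (fun w : R => `|w| `^ s)}.
Proof.
have [->/=|x0 _] := eqVneq x 0; last first.
  have h : {for `|x|, continuous (fun w : R => w `^ s)}.
    apply/differentiable_continuous/derivable1_diffP.
    by apply: derivable_powR; rewrite in_itv/= normr_gt0 x0.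
  exact: (cvg_comp _ _ (@norm_continuous _ _ x) h).
rewrite le_eqVlt => /predU1P[<-|s0].
  have -> : (fun w : R => `|w| `^ 0) = cst 1.
    by apply/funext => w; rewrite powRr0.
  exact: cvg_cst.
have rc : `|w| `^ s @[w --> 0^'+] --> (0 : R).
  apply: cvg_trans (powR_cvg0 s0); apply: near_eq_cvg; near=> w.
  by rewrite gtr0_norm.
apply/left_right_continuousP; rewrite normr0 powR0 ?gt_eqF//; split => //.
apply/cvg_at_leftNP; rewrite oppr0.
rewrite (_ : _ \o _ = fun w : R => `|w| `^ s)//.
by apply/funext => w /=; rewrite normrN.
Unshelve. all: by end_near. Qed.

Lemma integral_itv_powR a b s : 0 <= a -> a < b -> (0 < a) || (0 <= s) ->
  s + 1 != 0 ->
  (\int[mu]_(w in `[a, b]) (`|w| `^ s)%:E =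
   ((b `^ (s + 1) - a `^ (s + 1)) / (s + 1))%:E)%E.
Proof.
move=> a0 ab sa s1.
have cc : (0 < a) || (0 <= s + 1).
  by case/orP: sa => [->//|s0]; rewrite addr_ge0 ?orbT.
rewrite (@continuous_FTC2 _ _ (fun x => (s + 1)^-1 * x `^ (s + 1)))//.
- by rewrite -EFinB -mulrBr mulrC.
- apply: continuous_in_subspaceT => x; rewrite inE/= in_itv/= => /andP[ax xb].
  apply: continuous_normr_powR; case/orP: sa => [a0'|->]; last by rewrite orbT.
  by rewrite gt_eqF// (lt_le_trans a0').
(* Continuity of the primitive at the endpoints, possibly 0, is obtained with [|w|] in place of [w];
   the one-sided limits then transfer because [|w| = w] on that side. *)
- have cF x : (x != 0) || (0 <= s + 1) ->
      {for x, continuous (fun w : R => (s + 1)^-1 * `|w| `^ (s + 1))}.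
    by move=> /continuous_normr_powR ?; apply: cvgM => //; exact: cvg_cst.
  have b0 : 0 < b by exact: le_lt_trans ab.
  split.
  + move=> x; rewrite in_itv/= => /andP[ax _].
    apply: derivableM => //; apply: derivable_powR.
    by rewrite in_itv/= (le_lt_trans a0 ax).
  + have /cvg_at_right_filter :
        {for a, continuous (fun w : R => (s + 1)^-1 * `|w| `^ (s + 1))}.
      by apply: cF; case/orP: cc => [/gt_eqF->//|->]; rewrite orbT.
    rewrite /= ger0_norm//; apply: cvg_trans; apply: near_eq_cvg; near=> w.
    by rewrite ger0_norm// (le_trans a0).
  + have /cvg_at_left_filter :
        {for b, continuous (fun w : R => (s + 1)^-1 * `|w| `^ (s + 1))}.
      by apply: cF; rewrite gt_eqF.
    rewrite /= gtr0_norm//; apply: cvg_trans; apply: near_eq_cvg; near=> w.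
    rewrite ger0_norm//; apply/ltW/(le_lt_trans a0).
    by near: w; exact: nbhs_left_gt.
- move=> x; rewrite in_itv/= => /andP[ax _].
  have x0 : 0 < x by exact: le_lt_trans ax.
  have [_ d] := is_deriveZ (s + 1)^-1 (is_derive1_powR (s + 1) x0).
  by rewrite derive1E gtr0_norm// [LHS]d /GRing.scale/= addrK mulKf.
Unshelve. all: by end_near. Qed.

(** The annulus is two intervals exchanged by [w -> - w], and the integrand is even; hence the
    factor 2. *)
Lemma integral_annulus_powR a b s : 0 <= a -> a < b -> (0 < a) || (0 <= s) ->
  s + 1 != 0 ->
  (\int[mu]_(w in [set w | (a < `|w| < b)%R]) (`|w| `^ s)%:E =
   (2 * ((b `^ (s + 1) - a `^ (s + 1)) / (s + 1)))%:E)%E.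
Proof.
move=> a0 ab sa s1.
have mf (D : set R) : measurable_fun D (EFin \o (fun w : R => `|w| `^ s)).
  apply/measurable_EFinP/measurable_funTS.
  exact: (measurableT_comp (measurable_powR s)).
have -> : [set w : R | a < `|w| < b] =
    `]a, b[%classic `|` `](- b), (- a)[%classic.
  apply/seteqP; split => w /=; rewrite !in_itv/=.
    by case: ger0P => w0 /andP[h1 h2]; [left|right]; apply/andP; split; lra.
  by case: ger0P => w0 [] /andP[h1 h2]; apply/andP; split; lra.
rewrite ge0_integral_setU//=; last 2 first.
- exact: mf.
- apply/disj_setPRL => w /=; rewrite !in_itv/= => /andP[_ h] /andP[h' _]; lra.
rewrite -(@integral_itv_bndoo _ _ _ _ true false); last exact: mf.
rewrite -(@integral_itv_bndoo _ (- b) (- a) _ true false); last exact: mf.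
rewrite integration_by_substitution_oppr ?(ltW ab)//; last first.
  apply: continuous_in_subspaceT => x; rewrite inE/= in_itv/= => /andP[bx xa].
  apply: continuous_normr_powR; case/orP: sa => [a0'|->]; last by rewrite orbT.
  by rewrite lt_eqF//; lra.
under [X in (_ + X)%E]eq_integral do rewrite /= normrN.
by rewrite integral_itv_powR// -EFinD -mulr2n mulr_natl.
Qed.

End annulus_integral.

(** * Limits of L_p norms *)

Section norm_limits.
Context {R : realType}.
Let mu := @lebesgue_measure R.

Lemma cvg_normr_powR (u : nat -> R) (l s : R) : 0 <= s ->
  u @ \oo --> l -> (fun n => `|u n| `^ s) @ \oo --> `|l| `^ s.
Proof.
move=> s0 ul; have h : {for l, continuous (fun w : R => `|w| `^ s)}.
  by apply: continuous_normr_powR; rewrite s0 orbT.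
exact: (cvg_comp _ _ ul h).
Qed.

(** Eventually both integrals are finite and positive, and there the extended quotient of the roots
    is the root of the real quotient. *)
Lemma cvg_root_ratio (I J : nat -> \bar R) (A B p : R) : 0 < p ->
  0 < A -> 0 < B -> I @ \oo --> A%:E -> J @ \oo --> B%:E ->
  (fun m => (I m `^ p^-1 / J m `^ p^-1)%E) @ \oo --> ((A / B) `^ p^-1)%:E.
Proof.
move=> p0 A0 B0 IA JB.
have p1 : 0 <= p^-1 by rewrite invr_ge0 ltW.
have Jgt := cvgr_gt _ (fine_cvg JB) _ B0.
have Igt := cvgr_gt _ (fine_cvg IA) _ A0.
have Jfin := cvg_is_fine JB.
have Ifin := cvg_is_fine IA.
have L : (fun m => `|fine (I m) / fine (J m)| `^ p^-1) @ \oo -->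
    `|A / B| `^ p^-1.
  apply: cvg_normr_powR => //; apply: cvgM; first exact: fine_cvg.
  by apply: cvgV; [rewrite gt_eqF|exact: fine_cvg].
rewrite [`|A / B|]gtr0_norm ?divr_gt0// in L.
have {}L : (fun m => (`|fine (I m) / fine (J m)| `^ p^-1)%:E) @ \oo -->
    ((A / B) `^ p^-1)%:E.
  by apply: cvg_EFin L; exact: nearW.
apply: cvg_trans L; apply: near_eq_cvg; near=> m.
have Im : I m \is a fin_num by near: m.
have Jm : J m \is a fin_num by near: m.
have Ip : 0 < fine (I m) by near: m; exact: Igt.
have Jp : 0 < fine (J m) by near: m; exact: Jgt.
rewrite -(fineK Im) -(fineK Jm) !poweR_EFin inver gt_eqF ?powR_gt0//=.
rewrite gtr0_norm ?divr_gt0// powRM ?invr_ge0 ?(ltW Ip) ?(ltW Jp)// EFinM.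
by rewrite -[(fine (J m))^-1]powR_inv1 ?(ltW Jp)// -powRrM mulN1r powRN.
Unshelve. all: by end_near. Qed.

Lemma integrable_oneDsqrV :
  mu.-integrable setT (EFin \o (fun w : R => (1 + w ^+ 2)^-1)).
Proof.
have c : continuous (fun w : R => (oneDsqr w)^-1) by exact: continuous_oneDsqrV.
have g0 (w : R) : 0 <= (oneDsqr w)^-1.
  by rewrite invr_ge0 (le_trans ler01)// oneDsqr_ge1.
apply/integrableP; split.
  by apply/measurable_EFinP; exact: continuous_measurable_fun.
under eq_integral do rewrite /= (ger0_norm (g0 _)).
rewrite ge0_symfun_integralT; last 3 first.
- exact: g0.
- exact: c.
- by move=> w; rewrite /comp /oneDsqr sqrrN.
by rewrite -set_itvcy integral0y_oneDsqr -EFinM ltry.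
Qed.

(** Serves to discard the endpoints of the annulus, where the limit indicator jumps. *)
Lemma ae_excluding (s : seq R) (P : R -> Prop) :
  (forall w : R, w \notin s -> P w) -> {ae mu, forall w, P w}.
Proof.
move=> sP; exists [set` s].
have cs : countable [set` s] by apply/finite_set_countable/finite_seq.
split; last 1 first.
- by move=> w /= nP; apply: contrapT => /negP/sP.
- by apply: countable_measurable => // t; exact: measurable_set1.
- exact: countable_lebesgue_measure0.
Qed.

Variables (p c a b e : R) (G : nat -> R -> R).
Hypotheses (p1 : 1 < p) (c0 : 0 < c) (a0 : 0 <= a) (ab : a < b).
Hypotheses (ae : (0 < a) || (0 <= e)) (ep : e * p + 1 != 0).
Hypothesis mG : forall m, (0 < m)%N -> measurable_fun setT (G m).
Hypothesis G0 : forall m w, (0 < m)%N -> 0 <= G m w.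
Hypothesis dG : exists C, \forall m \near \oo,
  forall w, `|w| `^ e * G m w <= C / (1 + w ^+ 2).
Hypothesis cG : forall w : R, w \notin [:: 0; a; - a; b; - b] ->
  (fun m => G m w) @ \oo --> ((a < `|w| < b)%R%:R : R).

Let mA : measurable [set w : R | a < `|w| < b].
Proof.
have := @normr_measurable R setT measurableT _ (measurable_itv `]a, b[).
by rewrite setTI; congr measurable; apply/seteqP; split => w /=; rewrite in_itv.
Qed.

Let p0 : 0 <= p. Proof. by apply/ltW/(lt_trans ltr01). Qed.

(** Dominated convergence with majorant [(c C)^p / (1 + w^2)]: the [p]-th power of [(1 + w^2)^-1] is
    at most that number, as it is at most 1 and [p > 1]. *)
Lemma cvg_integral_annulus :
  (fun m => \int[mu]_w ((c * (`|w| `^ e * G m w)) `^ p)%:E)%E @ \oo -->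
  (c `^ p * (2 * ((b `^ (e * p + 1) - a `^ (e * p + 1)) / (e * p + 1))))%:E.
Proof.
have [C [m0 _ hC]] := dG.
pose f (w : R) := (c * (`|w| `^ e * (a < `|w| < b)%R%:R)) `^ p.
(* The limit is recognized as the integral of the pointwise limit [f]; off the annulus [f] is
   [powR 0 p], which is 0. *)
have -> : (c `^ p *
    (2 * ((b `^ (e * p + 1) - a `^ (e * p + 1)) / (e * p + 1))))%:E =
    (\int[mu]_w (f w)%:E)%E.
  rewrite EFinM -integral_annulus_powR//; last first.
    by case/orP: ae => [->//|e0]; rewrite mulr_ge0 ?orbT.
  have mp : measurable_fun setT (EFin \o (fun w : R => `|w| `^ (e * p))).
    by apply/measurable_EFinP; exact: (measurableT_comp (measurable_powR _)).
  rewrite integral_mkcond -ge0_integralZl//=; last 3 first.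
  - apply/(measurable_restrictT _ _).1; last exact: measurable_funTS.
    exact: mA.
  - by move=> w _; rewrite erestrict_ge0// => x _; rewrite lee_fin powR_ge0.
  - by rewrite lee_fin powR_ge0.
  apply: eq_integral => w _; rewrite patchE /f; case: ifPn.
    rewrite inE/= => ->; rewrite mulr1 powRM ?powR_ge0 ?(ltW c0)//.
    by rewrite EFinM -powRrM.
  rewrite notin_setE/= => /negP/negbTE ->.
  by rewrite !mulr0 powR0 ?mule0// gt_eqF// (lt_trans ltr01).
(* The bounds hold only for positive and large [m], whereas dominated convergence is applied with
   all indices; hence the shift. *)
pose N := maxn m0 1.
rewrite -(cvg_shiftn N).
have C0 : 0 <= C.
  have := hC N (leq_maxl _ _) 0; rewrite expr0n addr0 divr1.
  by apply: le_trans; rewrite mulr_ge0 ?powR_ge0// G0// leq_maxr.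
have N0 n : (0 < n + N)%N by rewrite (leq_trans (leq_maxr m0 1)) ?leq_addl.
have Nm n : (m0 <= n + N)%N by rewrite (leq_trans (leq_maxl m0 1)) ?leq_addl.
have [] := @dominated_convergence _ _ _ mu setT measurableT
  (fun n w => ((c * (`|w| `^ e * G (n + N)%N w)) `^ p)%:E) (EFin \o f)
  (fun w => ((c * C) `^ p)%:E * ((1 + w ^+ 2)^-1)%:E)%E.
- move=> n; apply/measurable_EFinP.
  apply: (measurableT_comp (measurable_powR p)) => //.
  apply: measurable_funM => //; apply: measurable_funM; last exact: mG.
  exact: (measurableT_comp (measurable_powR e)).
- apply/measurable_EFinP; apply: (measurableT_comp (measurable_powR p)) => //.
  apply: measurable_funM => //; apply: measurable_funM.
    exact: (measurableT_comp (measurable_powR e)).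
  rewrite (_ : (fun w : R => _) = \1_[set w : R | a < `|w| < b]).
    exact: measurable_indic.
  by apply/funext => w; rewrite indicE mem_setE.
- apply: (@ae_excluding [:: 0; a; - a; b; - b]) => w ws _.
  apply: cvg_EFin; first exact: nearW.
  have h : (fun n => c * (`|w| `^ e * G (n + N)%N w)) @ \oo -->
      c * (`|w| `^ e * (a < `|w| < b)%R%:R).
    apply: cvgM; first exact: cvg_cst.
    apply: cvgM; first exact: cvg_cst.
    by have := cG ws; rewrite -(cvg_shiftn N).
  have := cvg_normr_powR p0 h.
  have nn (x : R) : 0 <= x -> `|c * (`|w| `^ e * x)| = c * (`|w| `^ e * x).
    by move=> x0; rewrite ger0_norm// mulr_ge0 ?(ltW c0)// mulr_ge0 ?powR_ge0.
  rewrite nn//; apply: cvg_trans; apply: near_eq_cvg; apply: nearW => n /=.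
  by rewrite nn// G0.
- exact: integrableZl integrable_oneDsqrV.
- apply: aeW => w n _ /=.
  have w2 : 0 < (1 + w ^+ 2)^-1 <= 1.
    by rewrite invr_gt0 invf_le1 ?lerDl ?sqr_ge0 ?ltr_wpDr ?sqr_ge0.
  have w20 : 0 <= (1 + w ^+ 2)^-1 by case/andP: w2 => /ltW.
  have X0 : 0 <= `|w| `^ e * G (n + N)%N w by rewrite mulr_ge0 ?powR_ge0 ?G0.
  rewrite lee_fin ger0_norm ?powR_ge0//.
  apply: (@le_trans _ _ ((c * C * (1 + w ^+ 2)^-1) `^ p)).
    apply: ge0_ler_powR => //; rewrite ?nnegrE.
    - by rewrite mulr_ge0// ltW.
    - by rewrite mulr_ge0// mulr_ge0// ltW.
    by rewrite -mulrA ler_wpM2l ?(ltW c0)//; exact: (hC _ (Nm n) w).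
  rewrite powRM ?mulr_ge0 ?(ltW c0)//.
  by rewrite ler_wpM2l ?powR_ge0// ge1r_powR// ltW.
- by [].
Qed.
End norm_limits.

(** * Infinite products of complex numbers *)

Section complex_product.
Context {R : realType}.
Local Notation normc := ComplexField.Normc.normc.
Implicit Types (z : R[i]) (t : R).

Lemma normcE_Re_Im z :
  normc z = Num.sqrt (complex.Re z ^+ 2 + complex.Im z ^+ 2).
Proof. by case: z. Qed.

Lemma normc_ge0 z : 0 <= normc z.
Proof. by rewrite normcE_Re_Im sqrtr_ge0. Qed.

Lemma le_Re_normc z : `|complex.Re z| <= normc z.
Proof.
rewrite normcE_Re_Im -sqrtr_sqr ler_wsqrtr// lerDl sqr_ge0//.
Qed.

Lemma le_Im_normc z : `|complex.Im z| <= normc z.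
Proof. by rewrite normcE_Re_Im -sqrtr_sqr ler_wsqrtr// lerDr sqr_ge0. Qed.

Lemma normc_le_Re_Im z : normc z <= `|complex.Re z| + `|complex.Im z|.
Proof.
have h : 0 <= `|complex.Re z| + `|complex.Im z| by rewrite addr_ge0.
rewrite normcE_Re_Im -[leRHS]ger0_norm// -sqrtr_sqr ler_wsqrtr//.
rewrite sqrrD !real_normK ?num_real// addrAC lerDl mulrn_wge0// mulr_ge0//.
Qed.

Lemma normc_sum (I : Type) (r : seq I) (F : I -> R[i]) :
  normc (\sum_(i <- r) F i) <= \sum_(i <- r) normc (F i).
Proof.
elim/big_ind2 : _ => //; first by rewrite ComplexField.Normc.normc0.
by move=> x1 x2 y1 y2 h1 h2; apply: le_trans (le_normcD _ _) _; exact: lerD.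
Qed.

Lemma normc_prod (I : Type) (r : seq I) (F : I -> R[i]) :
  normc (\prod_(i <- r) F i) = \prod_(i <- r) normc (F i).
Proof.
by elim/big_ind2 : _ => //; [exact: ComplexField.Normc.normc1|
  move=> x1 x2 y1 y2 <- <-; exact: ComplexField.Normc.normcM].
Qed.

Lemma normc_expiB1 t : normc (expi t - 1) <= 2 * `|t|.
Proof.
apply: le_trans (normc_le_Re_Im _) _.
rewrite /expi /= subr0 mulr_natl mulr2n lerD ?normr_sin_le//.
by rewrite ler0_norm ?subr_le0 ?cos_le1// opprB cos_ge_1B.
Qed.

(** With this, [H (w / 2^l)] approaches 1 geometrically, and the infinite product converges. [C] may
    depend on the mask: only convergence for a fixed [m] is drawn from it. *)
Lemma trig_poly_lipschitz (H : R -> R[i]) (L : nat) (h : nat -> R[i]) :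
    (forall t, H t = \sum_(0 <= nu < L.+1) h nu * expi (- (nu%:R * t))) ->
    H 0 = 1 ->
  exists2 C : R, 0 <= C & forall t, normc (H t - 1) <= C * `|t|.
Proof.
move=> HE H0; exists (\sum_(0 <= nu < L.+1) normc (h nu) * (2 * nu%:R)).
  by apply: sumr_ge0 => nu _; rewrite !mulr_ge0 ?normc_ge0.
move=> t; rewrite -H0 !HE -sumrB mulr_suml; apply: le_trans (normc_sum _ _) _.
apply: ler_sum => nu _; rewrite -mulrBr ComplexField.Normc.normcM.
rewrite -[leRHS]mulrA ler_wpM2l ?normc_ge0// mulr0 oppr0.
have -> : expi (0 : R) = 1 by rewrite /expi cos0 sin0.
apply: le_trans (normc_expiB1 _) _.
by rewrite normrN normrM normr_nat mulrA.
Qed.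

(* Adding the increasing sequence C (1 - 2^-n) makes u nondecreasing. *)
Lemma cvg_dyadic_increments (u : nat -> R) (C M : R) : 0 <= C ->
    (forall n, `|u n.+1 - u n| <= C / 2 ^+ n.+1) ->
    (forall n, `|u n| <= M) ->
  cvgn u.
Proof.
move=> C0 du uM; pose v n := C * (1 - 2 ^- n).
have v01 n : 0 <= v n <= C.
  have h : 0 <= (2 ^- n : R) <= 1.
    by rewrite invr_ge0 exprn_ge0//= invf_le1 ?exprn_gt0// exprn_ege1// ler1n.
  by rewrite /v; apply/andP; split; nra.
have vc : v @ \oo --> C.
  rewrite -[X in _ --> X]mulr1 -[X in _ * X](subr0 1).
  apply: cvgM; first exact: cvg_cst.
  apply: cvgB; first exact: cvg_cst.
  rewrite (_ : (fun n => _) = GRing.exp 2^-1).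
    by apply: cvg_expr; rewrite ger0_norm ?invr_ge0// invf_lt1// ltr1n.
  by apply/funext => n; rewrite exprVn.
have uvc : cvgn (u \+ v).
  apply: (@nondecreasing_is_cvgn _ (u \+ v)).
    apply/nondecreasing_seqP => n /=; have := du n.
    have : (2 ^- n : R) = 2 * 2 ^- n.+1.
      by rewrite exprS invfM mulrA mulfV ?mul1r.
    by rewrite ler_norml /v => -> /andP[h _]; set d := 2 ^- n.+1 in h *; lra.
  exists (M + C) => _ [n _ <-] /=.
  by rewrite lerD ?(le_trans (ler_norm _) (uM _))//; case/andP: (v01 n).
have -> : u = (u \+ v) \- v by apply/funext => n /=; rewrite addrK.
by apply: is_cvgB => //; exact: cvgP vc.
Qed.

Lemma cvg_complex (P : nat -> R[i]^o) (x y : R) :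
  (fun n => complex.Re (P n)) @ \oo --> x ->
  (fun n => complex.Im (P n)) @ \oo --> y -> P @ \oo --> (x +i* y : R[i]^o).
Proof.
(* A positive element of [R[i]] is real, so the radius has imaginary part 0. *)
move=> Px Py; apply/cvgrPdist_lt => -[e e']; rewrite ltcE/= => /andP[/eqP-> e0].
have e2 : 0 < e / 2 by rewrite divr_gt0.
move/cvgrPdist_lt : Px => /(_ _ e2) Px; move/cvgrPdist_lt : Py => /(_ _ e2) Py.
near=> n.
have -> : `|(x +i* y : R[i]^o) - P n| = (normc ((x +i* y) - P n))%:C by [].
rewrite ltcR; apply: le_lt_trans (normc_le_Re_Im _) _.
have -> : complex.Re ((x +i* y) - P n) = x - complex.Re (P n) by case: (P n).
have -> : complex.Im ((x +i* y) - P n) = y - complex.Im (P n) by case: (P n).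
by rewrite [e]splitr ltrD//; near: n.
Unshelve. all: by end_near. Qed.

Lemma cvg_normc (P : nat -> R[i]) (x y : R) :
  (fun n => complex.Re (P n)) @ \oo --> x ->
  (fun n => complex.Im (P n)) @ \oo --> y ->
  (fun n => normc (P n)) @ \oo --> normc (x +i* y).
Proof.
move=> Px Py.
have h : (fun n => complex.Re (P n) ^+ 2 + complex.Im (P n) ^+ 2) @ \oo -->
    x ^+ 2 + y ^+ 2 by rewrite !expr2; apply: cvgD; apply: cvgM.
rewrite (_ : (fun n => _) =
    Num.sqrt \o (fun n => complex.Re (P n) ^+ 2 + complex.Im (P n) ^+ 2)).
  exact: (cvg_comp _ _ h (@sqrt_continuous R _)).
by apply/funext => n; rewrite normcE_Re_Im.
Qed.

(** [infprod] is a [lim], informative only once the partial products converge. Their increments are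
    [P n * (u n.+1 - 1)] with [|P n| <= 1], so real and imaginary parts have geometrically small
    increments. *)
Lemma cvg_normc_infprod (u : nat -> R[i]) (C : R) : 0 <= C ->
    (forall l, normc (u l) <= 1) ->
    (forall l, normc (u l - 1) <= C / 2 ^+ l) ->
  (fun n => \prod_(1 <= l < n.+1) normc (u l)) @ \oo --> normc (infprod u).
Proof.
move=> C0 u1 uC; pose P n := \prod_(1 <= l < n.+1) u l.
have P1 n : normc (P n) <= 1.
  rewrite normc_prod; apply: prodr_ile1 => l _; rewrite normc_ge0 u1//.
have dP n : normc (P n.+1 - P n) <= C / 2 ^+ n.+1.
  rewrite /P big_nat_recr//= -[X in _ - X]mulr1 -mulrBr.
  rewrite ComplexField.Normc.normcM.
  by apply: le_trans (uC n.+1); apply: ler_piMl; [exact: normc_ge0|exact: P1].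
have Rec : cvgn (fun n => complex.Re (P n)).
  have ReP n := le_trans (le_Re_normc (P n)) (P1 n).
  apply: cvg_dyadic_increments C0 _ ReP => n.
  rewrite -raddfB; exact: le_trans (le_Re_normc _) (dP n).
have Imc : cvgn (fun n => complex.Im (P n)).
  have ImP n := le_trans (le_Im_normc (P n)) (P1 n).
  apply: cvg_dyadic_increments C0 _ ImP => n.
  rewrite -raddfB; exact: le_trans (le_Im_normc _) (dP n).
rewrite /infprod (cvg_lim _ (@cvg_complex P _ _ Rec Imc))//.
under eq_fun do rewrite -normc_prod.
exact: cvg_normc Rec Imc.
Qed.

End complex_product.

(** * Daubechies scaling functions and wavelets *)

Lemma powRD1_div (R : realType) (x s : R) : 0 < x -> x `^ (s + 1) / x = x `^ s.
Proof.
move=> x0; rewrite powRD; last by rewrite (gt_eqF x0) implybT.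
by rewrite powRr1 ?ltW// mulfK ?gt_eqF.
Qed.

Section daubechies_limits.
Context {R : realType}.
Local Notation normc := ComplexField.Normc.normc.
Let mu := @lebesgue_measure R.

Lemma normcXz_imaginary (w : R) (k : nat) :
  normc ((0 +i* w : R[i]) ^ k%:Z) = `|w| ^+ k /\
  normc ((0 +i* w : R[i]) ^ (- k%:Z)) = `|w| ^- k.
Proof.
have nw : normc (0 +i* w) = `|w| by rewrite /= expr0n add0r sqrtr_sqr.
have nX n : normc ((0 +i* w : R[i]) ^+ n) = `|w| ^+ n.
  elim: n => [|n IH]; first by rewrite !expr0 ComplexField.Normc.normc1.
  by rewrite !exprS ComplexField.Normc.normcM IH nw.
by rewrite -exprnN -exprnP ComplexField.Normc.normcV nX.
Qed.

Lemma LpnormC_modulus (p : R) (f : R -> R[i]) (F : R -> R) :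
  (forall w, normc (f w) = F w) ->
  LpnormC p f = ((\int[mu]_w (F w `^ p)%:E) `^ p^-1)%E.
Proof.
move=> fF; rewrite /LpnormC unlock; congr (_ `^ _)%E; apply: eq_integral => w _.
by rewrite fF abse_EFin ger0_norm -?fF ?normc_ge0// fF poweR_EFin.
Qed.

(* The modulus of the transform of f_m is c (G m), and G m tends to the
   indicator of a < |w| < b. *)
Lemma cvg_Ckp (p c a b e : R) (j : int) (G : nat -> R -> R)
    (f : nat -> R -> R[i]) :
    1 < p -> 0 < c -> 0 <= a -> a < b -> (0 < a) || (0 <= e) ->
    e * p + 1 != 0 ->
    0 < (b `^ (e * p + 1) - a `^ (e * p + 1)) / (e * p + 1) ->
    (forall m, (0 < m)%N -> measurable_fun setT (G m)) ->
    (forall m w, (0 < m)%N -> 0 <= G m w) ->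
    (exists C, \forall m \near \oo,
      forall w, `|w| `^ e * G m w <= C / (1 + w ^+ 2)) ->
    (exists C, \forall m \near \oo,
      forall w, G m w <= C / (1 + w ^+ 2)) ->
    (forall w : R, w \notin [:: 0; a; - a; b; - b] ->
      (fun m => G m w) @ \oo --> ((a < `|w| < b)%R%:R : R)) ->
    (forall w : R, normc ((0 +i* w : R[i]) ^ (- j)) = `|w| `^ e) ->
    (forall m w, (0 < m)%N -> normc (fourier (f m) w) = c * G m w) ->
  (fun m => Ckp j p (f m)) @ \oo -->
    (((b `^ (e * p + 1) - a `^ (e * p + 1)) / (e * p + 1) / (b - a))
       `^ p^-1)%:E.
Proof.
move=> p1 c0 a0 ab ae ep A0 mG G0 dG dG0 cG je fG.
have p0 : 0 < p by exact: lt_trans p1.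
have I := cvg_integral_annulus p1 c0 a0 ab ae ep mG G0 dG cG.
(* The denominator is the case [e = 0] of the same lemma; [powR _ 0] is 1 everywhere, also at 0. *)
have J : (fun m => \int[mu]_w ((c * G m w) `^ p)%:E)%E @ \oo -->
    (c `^ p * (2 * (b - a)))%:E.
  have b0 : 0 <= b by apply: le_trans (ltW ab).
  have := @cvg_integral_annulus _ p c a b 0 G p1 c0 a0 ab.
  rewrite lexx orbT mul0r add0r oner_eq0 => /(_ isT isT mG G0 _ cG).
  rewrite !powRr1// divr1 (_ : (fun m => _) =
      fun m => (\int[mu]_w ((c * G m w) `^ p)%:E)%E); last first.
    by apply/funext => m; apply: eq_integral => w _; rewrite powRr0 mul1r.
  apply; have [C hC] := dG0; exists C.
  by apply: filterS hC => m h' w; rewrite powRr0 mul1r.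
have cp0 : 0 < c `^ p by rewrite powR_gt0.
have two0 : 0 < 2 :> R by [].
have ba0 : 0 < b - a by rewrite subr_gt0.
have := cvg_root_ratio p0 (mulr_gt0 cp0 (mulr_gt0 two0 A0))
  (mulr_gt0 cp0 (mulr_gt0 two0 ba0)) I J.
rewrite -mulf_div divff ?gt_eqF// mul1r -mulf_div divff ?gt_eqF// mul1r.
apply: cvg_trans; apply: near_eq_cvg; near=> m.
have m0 : (0 < m)%N by near: m; exact: nbhs_infty_gt.
rewrite /Ckp (LpnormC_modulus p (fun w => fG m w m0)).
rewrite (@LpnormC_modulus p _ (fun w => c * (`|w| `^ e * G m w)))// => w.
by rewrite /fourier_shift ComplexField.Normc.normcM je fG// mulrCA.
Unshelve. all: by end_near. Qed.

Variables (H : nat -> R -> R[i]).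
Hypothesis hH : forall m : nat, (0 < m)%N -> is_daubechies_mask m (H m).

Let h m (t : R) : R := normc (H m t).
Let g m (w : R) : R := normc (infprod (fun l => H m (w / 2 ^+ l))).

Let hh m : (0 < m)%N -> low_pass_modulus m (h m).
Proof.
move=> m0; have [q [hq q1 qneg qpos]] := daubechies_mask_modulus m0 (hH m0).
have c1 (t : R) : -1 <= cos t <= 1 by rewrite cos_geN1 cos_le1.
split=> [t|t c0|t c0]; rewrite /h.
- rewrite normc_ge0/= -(@expr_le1 _ 2) ?normc_ge0// hq q1//.
- by rewrite hq sin2cos2 qneg// cos_geN1.
- by rewrite hq sin2cos2 qpos// c0 cos_le1.
Qed.

Let hg m : (0 < m)%N -> dyadic_product (h m) (g m).
Proof.
move=> m0 w; have [[L [c HE]] _ H0] := hH m0.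
have [C C0 HC] := trig_poly_lipschitz HE H0.
apply: (@cvg_normc_infprod _ _ (C * `|w|)); first by rewrite mulr_ge0.
- by move=> l; have [/(_ (w / 2 ^+ l))/andP[]] := hh m0.
- move=> l; apply: le_trans (HC _) _.
  by rewrite normrM normfV normrX [`|2|]ger0_norm// mulrA.
Qed.

Let mh m : (0 < m)%N -> measurable_fun setT (h m).
Proof.
move=> m0; have [q [hq _ _ _]] := daubechies_mask_modulus m0 (hH m0).
apply: continuous_measurable_fun => t.
have -> : h m = Num.sqrt \o (horner q \o cos).
  by apply/funext => x /=; rewrite -hq sqrtr_sqr ger0_norm ?normc_ge0.
apply: continuous_comp; last exact: sqrt_continuous.
by apply: continuous_comp; [exact: continuous_cos|exact: continuous_horner].
Qed.

Let mh_affine m (a b : R) : (0 < m)%N ->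
  measurable_fun setT (fun w : R => h m (w * a + b)).
Proof.
move=> m0; apply: (measurableT_comp (mh m0)).
by apply: measurable_funD => //; apply: measurable_funM.
Qed.

Let mg m : (0 < m)%N -> measurable_fun setT (g m).
Proof.
move=> m0; have := @measurable_fun_cvg _ _ R setT
  (fun n (w : R) => \prod_(1 <= l < n.+1) h m (w / 2 ^+ l)) (g m).
apply; last by move=> w _; exact: hg.
move=> n.
elim: n => [|n IH].
  rewrite (_ : (fun w => _) = cst 1); first exact: measurable_cst.
  by apply/funext => w; rewrite big_geq.
rewrite (_ : (fun w => _) = (fun w => \prod_(1 <= l < n.+1) h m (w / 2 ^+ l)) \*
    (fun w => h m (w * 2 ^- n.+1 + 0))); last first.
  by apply/funext => w; rewrite big_nat_recr//= addr0.
by apply: measurable_funM => //; exact: mh_affine.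
Qed.

Variables (p : R) (k : nat) (phi psi : nat -> R -> R[i]).
Hypothesis p1 : 1 < p.

Let c : R := (Num.sqrt (2 * pi))^-1.

Let c0 : 0 < c.
Proof. by rewrite invr_gt0 sqrtr_gt0 mulr_gt0// pi_gt0. Qed.

Let normc_real (x : R) : 0 <= x -> normc x%:C = x.
Proof. by move=> x0; rewrite /= expr0n addr0 sqrtr_sqr ger0_norm. Qed.

Lemma cvg_Ckp_scaling :
    (forall m, (0 < m)%N -> is_scaling_function (H m) (phi m)) ->
  (fun m => Ckp (- k%:Z) p (phi m)) @ \oo -->
  (pi ^+ k / (1 + p * k%:R) `^ p^-1)%:E.
Proof.
move=> hphi; set s := k%:R * p + 1.
have p0 : 0 < p by exact: lt_trans p1.
have s0 : 0 < s by rewrite ltr_wpDl// mulr_ge0// ltW.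
have pis : 0 < (pi : R) `^ s by rewrite powR_gt0// pi_gt0.
(* The annulus is [0 < |w| < pi] and the exponent [k]: [pi^s / s / pi = pi^(k p) / s], whose [p]-th
   root has numerator [pi^k]. *)
have -> : pi ^+ k / (1 + p * k%:R) `^ p^-1 =
    ((pi `^ s - 0 `^ s) / s / (pi - 0)) `^ p^-1.
  rewrite powR0 ?gt_eqF// !subr0 mulrAC (powRD1_div _ (pi_gt0 R)).
  rewrite powRM ?powR_ge0 ?invr_ge0 ?(ltW s0)// -powRrM mulfK ?gt_eqF//.
  rewrite powR_mulrn ?pi_ge0// /s addrC [p * _]mulrC; congr (_ * _).
  by rewrite -powRN -mulN1r powRrM powR_inv1// addr_ge0// mulr_ge0// ltW.
apply: (@cvg_Ckp p c 0 pi k%:R (- k%:Z) g) => //.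
- exact: pi_gt0.
- by rewrite ler0n orbT.
- by rewrite gt_eqF.
- by rewrite powR0 ?gt_eqF// subr0 divr_gt0.
- by move=> m w _; exact: normc_ge0.
- have [C hC] := dyadic_product_dominated hh hg k; exists C.
  by apply: filterS hC => m h' w; rewrite powR_mulrn.
- have [C hC] := dyadic_product_dominated hh hg 0; exists C.
  by apply: filterS hC => m h' w; have := h' w; rewrite expr0 mul1r.
- move=> w; rewrite !inE !negb_or oppr0 => /and5P[w0 _ _ wpi wNpi].
  rewrite normr_gt0 w0/=; case: ltgtP => [h'|h'|h'].
  + exact: dyadic_product_cvg1 hh hg _ h'.
  + exact: dyadic_product_cvg0 hh hg _ h'.
  + move: h'; case: ger0P => _ h'; first by rewrite h' eqxx in wpi.
    by rewrite -h' opprK eqxx in wNpi.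
- by move=> w; rewrite opprK (normcXz_imaginary w k).1 powR_mulrn.
- move=> m w m0; rewrite (hphi m m0).2 ComplexField.Normc.normcM.
  by rewrite normc_real// ltW.
Qed.

Lemma cvg_Ckp_wavelet :
    (forall m, (0 < m)%N -> is_wavelet_function (H m) (psi m)) ->
  (fun m => Ckp k%:Z p (psi m)) @ \oo -->
  (pi ^- k * ((1 - 2 `^ (1 - p * k%:R)) / (p * k%:R - 1)) `^ p^-1)%:E.
Proof.
move=> hpsi; set s := - k%:R * p + 1.
have p0 : 0 < p by exact: lt_trans p1.
have pi0 := pi_gt0 R.
(* [s = 1 - k p] is 1 for [k = 0], and [k p >= p > 1] otherwise. *)
have s0 : s != 0.
  rewrite /s; case: (k) => [|n]; first by rewrite oppr0 mul0r add0r oner_eq0.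
  rewrite lt_eqF// mulNr addrC subr_lt0 (lt_le_trans p1)//.
  rewrite ler_peMl// ?(ltW p0)//.
  by rewrite ler1n.
have pis : 0 < (pi : R) `^ s by rewrite powR_gt0.
have lt1 (t : R) : 0 < t -> 1 < 2 `^ t.
  move=> t0; have := @gt0_ltr_powR _ t t0 1 2.
  by rewrite powR1 !nnegrE; apply=> //; rewrite ltr1n.
(* Numerator and denominator have the same sign, whichever that is. *)
have B0 : 0 < (2 `^ s - 1) / s.
  have [sn|sp|se] := ltgtP s 0; last by rewrite se eqxx in s0.
    rewrite -mulrNN -invrN mulr_gt0 ?invr_gt0 ?oppr_gt0// subr_lt0.
    by rewrite -[s]opprK powRN invf_lt1 ?powR_gt0// lt1 ?oppr_gt0.
  by rewrite divr_gt0// subr_gt0 lt1.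
have AE : ((pi *+ 2) `^ s - pi `^ s) / s = pi `^ s * ((2 `^ s - 1) / s).
  rewrite -[pi *+ 2]mulr_natl powRM ?(ltW pi0)// mulrA mulrBr mulr1.
  by rewrite [pi `^ s * _]mulrC.
(* The annulus has [b - a = pi], so the power of [pi] is [pi^(s-1) = pi^(-k p)], with root [pi^-k];
   the signs in the remaining fraction are reversed. *)
have -> : pi ^- k * ((1 - 2 `^ (1 - p * k%:R)) / (p * k%:R - 1)) `^ p^-1 =
    (((pi *+ 2) `^ s - pi `^ s) / s / (pi *+ 2 - pi)) `^ p^-1.
  rewrite AE mulr2n addrK mulrAC (powRD1_div _ pi0).
  rewrite [RHS]powRM ?powR_ge0 ?(ltW B0)// -powRrM mulfK ?gt_eqF//.
  rewrite powR_invn ?(ltW pi0)//; congr (_ * _ `^ _).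
  have -> : 1 - p * k%:R = s by rewrite /s; ring.
  have -> : p * k%:R - 1 = - s by rewrite /s; ring.
  by rewrite invrN mulrN -mulNr opprB.
(* The wavelet's product starts at [w / 4], so it is the scaling product taken at [w / 2]. *)
pose G m w := h m (w / 2 + pi) * g m (w / 2).
have w2 (w : R) : `|w / 2| = `|w| / 2 by rewrite normrM normfV [`|2|]ger0_norm.
apply: (@cvg_Ckp p c pi (pi *+ 2) (- k%:R) k%:Z G) => //.
- exact: ltW.
- by rewrite mulr2n ltrDl.
- by rewrite pi0.
- by rewrite AE mulr_gt0.
- move=> m m0; apply: measurable_funM; first exact: mh_affine.
  apply: (measurableT_comp (mg m0)); exact: measurable_funM.
- by move=> m w _; rewrite mulr_ge0 ?normc_ge0.
- have [C hC] := wavelet_modulus_dominated hh hg k; exists C.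
  by apply: filterS hC => m h' w; rewrite powR_invn.
- have [C hC] := wavelet_modulus_dominated hh hg 0; exists C.
  by apply: filterS hC => m h' w; have := h' w; rewrite expr0 invr1 mul1r.
- move=> w; rewrite !inE !negb_or => /and5P[w0 wa wNa wb wNb].
  have h1 : `|w| < pi *+ 2 -> (fun m => g m (w / 2)) @ \oo --> (1 : R).
    move=> wpi; apply: (dyadic_product_cvg1 hh hg).
    by rewrite w2 ltr_pdivrMr// mulr_natr.
  (* Between [pi] and [2 pi] both factors tend to 1. Beyond [2 pi] the product tends to 0 and
     [h <= 1]; below [pi] the high-pass factor tends to 0 and the product to 1. *)
  case: (ltgtP pi `|w|) => [wpi|wpi|wpi]/=.
  + have [w2pi|w2pi|w2pi] := ltgtP `|w| (pi *+ 2).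
    * rewrite -[X in _ --> X]mulr1; apply: cvgM; last exact: h1.
      apply: (low_pass_modulus_cvg1 hh).
      rewrite cosDpi oppr_gt0 -cos_norm w2 -[X in cos X](subrK (pi / 2)).
      by rewrite cosDpihalf oppr_lt0 sin_gt0_pi//; apply/andP; split; lra.
    * have g0 : (fun m => g m (w / 2)) @ \oo --> (0 : R).
        apply: (dyadic_product_cvg0 hh hg).
        by rewrite w2 ltr_pdivlMr// mulr_natr.
      apply: squeeze_cvgr (cvg_cst _) g0; near=> m.
      have m0 : (0 < m)%N by near: m; exact: nbhs_infty_gt.
      have [/(_ (w / 2 + pi))/andP[h0 h1'] _ _] := hh m0.
      by rewrite mulr_ge0 ?normc_ge0//= ler_piMl ?normc_ge0.
    * move: w2pi; case: ger0P => _ h'; first by rewrite h' eqxx in wb.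
      by rewrite -h' opprK eqxx in wNb.
  + rewrite -[X in _ --> X](mul0r 1); apply: cvgM; last first.
      by apply: h1; rewrite (lt_trans wpi)// mulr2n ltrDl.
    apply: (low_pass_modulus_cvg0 hh).
    rewrite cosDpi oppr_lt0 cos_gt0_pihalf// -ltr_norml w2.
    by rewrite ltr_pM2r.
  + move: wpi; case: ger0P => _ h'; first by rewrite h' eqxx in wa.
    by rewrite h' opprK eqxx in wNa.
- by move=> w; rewrite (normcXz_imaginary w k).2 powR_invn.
- move=> m w m0; rewrite (hpsi m m0).2 !ComplexField.Normc.normcM.
  rewrite normc_real ?(ltW c0)//.
  rewrite -mulrA; congr (_ * (_ * normc (infprod _))).
  by apply/funext => l; rewrite exprS invfM mulrA.
Unshelve. all: by end_near. Qed.

End daubechies_limits.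

Theorem corollary2 (R : realType) (p : R) (hp : 1 < p) (k : nat)
  (H phi psi : nat -> R -> R[i])
  (hH : forall m : nat, (0 < m)%N -> is_daubechies_mask m (H m))
  (hphi : forall m : nat, (0 < m)%N -> is_scaling_function (H m) (phi m))
  (hpsi : forall m : nat, (0 < m)%N -> is_wavelet_function (H m) (psi m)) :
  ((fun m : nat => Ckp (- k%:Z) p (phi m)) @ \oo -->
     (pi ^+ k / (1 + p * k%:R) `^ p^-1)%:E) /\
  ((fun m : nat => Ckp k%:Z p (psi m)) @ \oo -->
     (pi ^- k * ((1 - 2 `^ (1 - p * k%:R)) / (p * k%:R - 1)) `^ p^-1)%:E).
Proof.
split; first exact: (cvg_Ckp_scaling hH hp hphi).
exact: (cvg_Ckp_wavelet hH hp hpsi).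
Qed.
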